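(* Let $k\geq 2$ and $n\geq k^{3}+2k^{2}+2k$ be integers. Then \[ \hat{r}(K_{1,k},K_{n})=\hat{r}^{*}(K_{1,k},K_{n})=\begin{cases}\binom{k(n-1)+1}{2}-\binom{k}{2} & \text{if } k \text{ is odd},\\[4pt] \binom{k(n-1)+1}{2}-k(n-1)/2 & \text{if } k \text{ is even}.\end{cases} \]
   Context: All graphs are finite and simple. $K_{1,k}$ is the star with $k$ edges and $K_n$ is the complete graph on $n$ vertices. For graphs $F,G,H$, write $F\longrightarrow(G,H)$ if every colouring of the edges of $F$ with red and blue yields a red copy of $G$ or a blue copy of $H$. The Ramsey number $r(G,H)$ is the least integer $N$ with $K_N\longrightarrow(G,H)$. The size Ramsey number $\hat{r}(G,H)$ is the minimum number of edges of a graph $F$ with $F\longrightarrow(G,H)$. The restricted size Ramsey number is $\hat{r}^{*}(G,H)=\min\{|E(F)| : F\longrightarrow(G,H),\ |V(F)|=r(G,H)\}$. *)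

(* Defs.v *)
From mathcomp Require Import all_boot.

Set Implicit Arguments.
Unset Strict Implicit.
Unset Printing Implicit Defensive.

Record sgraph := SGraph {
  vertex :> finType;
  edge : rel vertex;
  edge_sym : symmetric edge;
  edge_irrefl : irreflexive edge }.

Definition edge_set (G : sgraph) : {set {set G}} :=
  [set [set p.1; p.2] | p : G * G & edge p.1 p.2].

Definition num_edges (G : sgraph) : nat := #|edge_set G|.

(* [F] contains a copy of [G] as a not necessarily induced subgraph. *)
Definition contains_copy (F G : sgraph) : Prop :=
  exists2 f : G -> F, injective f & forall x y, edge x y -> edge (f x) (f y).

Lemma complete_sym n : symmetric (fun x y : 'I_n => x != y).
Proof. by move=> x y; rewrite eq_sym. Qed.

Lemma complete_irrefl n : irreflexive (fun x y : 'I_n => x != y).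
Proof. by move=> x; rewrite eqxx. Qed.

Definition complete (n : nat) : sgraph :=
  SGraph (@complete_sym n) (@complete_irrefl n).

(* The centre of the star is [None], its leaves are the [Some i]. *)
Definition star_edge k (x y : option 'I_k) : bool := isSome x (+) isSome y.

Lemma star_sym k : symmetric (@star_edge k).
Proof. by move=> x y; rewrite /star_edge addbC. Qed.

Lemma star_irrefl k : irreflexive (@star_edge k).
Proof. by move=> x; rewrite /star_edge addbb. Qed.

Definition star (k : nat) : sgraph := SGraph (@star_sym k) (@star_irrefl k).

(* A red/blue colouring of the edges of [F] is a function [c] on all sets of
   vertices, of which only the values on [edge_set F] are ever used;
   [colour_class c true] is the red graph and [colour_class c false] the blue
   one. *)
Section ColourClass.
Variables (F : sgraph) (c : {set F} -> bool) (b : bool).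

Definition colour_edge (x y : F) : bool := edge x y && (c [set x; y] == b).

Lemma colour_sym : symmetric colour_edge.
Proof. by move=> x y; rewrite /colour_edge edge_sym setUC. Qed.

Lemma colour_irrefl : irreflexive colour_edge.
Proof. by move=> x; rewrite /colour_edge edge_irrefl. Qed.

Definition colour_class : sgraph := SGraph colour_sym colour_irrefl.
End ColourClass.

Definition arrows (F G H : sgraph) : Prop :=
  forall c : {set F} -> bool,
    contains_copy (colour_class c true) G \/
    contains_copy (colour_class c false) H.

Definition is_min (P : nat -> Prop) (m : nat) : Prop :=
  P m /\ forall m', P m' -> m <= m'.

(* The three Ramsey parameters are given by their graphs: [is_ramsey G H N]
   says that r(G,H) is defined and equal to [N], and so on. *)
Definition is_ramsey (G H : sgraph) : nat -> Prop :=
  is_min (fun N => arrows (complete N) G H).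

Definition is_size_ramsey (G H : sgraph) : nat -> Prop :=
  is_min (fun m => exists F : sgraph, arrows F G H /\ num_edges F = m).

Definition is_restricted_size_ramsey (G H : sgraph) : nat -> Prop :=
  is_min (fun m => exists F : sgraph,
    [/\ arrows F G H, is_ramsey G H #|F| & num_edges F = m]).

(* Main.v *)
(** Write q = n - 1 and N = kq + 1.  If the vertices of F split into q classes
    inducing maximum degree < k, colouring the edges inside the classes red
    shows that F does not arrow.

    For the lower bound, let H be a vertex set that does not split into q
    classes.  By Lovász's partition argument H has a vertex of degree at least
    kq, and this stays true, with kq replaced by k(q - i), after deleting any
    i admissible classes.  Greedy deletion gives a first bound on e(H).  Call S
    with |S| = k + 1 defective if every vertex of S has a non-neighbour in S:
    S is then an admissible class with one vertex too many, and deleting a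
    defective class of vertices of large degree gains edges on the bound.  When
    no such class exists, the vertices of degree close to kq form a clique up
    to k vertices or up to a matching, and k of them can be deleted without
    losing anything.  Descending to q = 2k + 2, the bound misses the target by
    at most O(k^3) edges.  At the original level n >= k^3 + 2k^2 + 2k, a single
    defective class would make up for this deficit, so there is none among the
    vertices of degree at least kq - 2k, and every vertex misses fewer than k of
    these.  Hence there are at least N of them, and N vertices without a
    defective class already span enough edges.

    For the upper bound, delete from the complete graph on N vertices a clique
    on k vertices (k odd) or a matching missing one vertex (k even). *)
Require Import Defs.
From mathcomp Require Import all_boot zify.

Set Implicit Arguments.
Unset Strict Implicit.
Unset Printing Implicit Defensive.

(** * Subsets of given size, degrees and edge counts *)

Lemma ex_subset_card (T : finType) (A : {set T}) m :
  m <= #|A| -> exists2 B : {set T}, B \subset A & #|B| = m.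
Proof.
rewrite -bin_gt0 -cards_draws => /card_gt0P[B]; rewrite inE => /andP[sBA /eqP].
by exists B.
Qed.

Lemma ex_between_card (T : finType) (A C : {set T}) m :
    C \subset A -> #|C| <= m <= #|A| ->
  exists B : {set T}, [/\ C \subset B, B \subset A & #|B| = m].
Proof.
move=> sCA /andP[leCm lemA].
have sum := cardsID C A; rewrite (setIidPr sCA) in sum.
have /ex_subset_card[B sBAC cB] : m - #|C| <= #|A :\: C| by lia.
exists (C :|: B); split; first exact: subsetUl.
  by rewrite subUset sCA (subset_trans sBAC) ?subsetDl.
have disj : [disjoint C & B].
  rewrite disjoint_sym; apply: disjointWl sBAC _.
  by rewrite -setI_eq0 setIDAC setDIl setDv setI0.
by move: disj; rewrite -leq_card_setU => /eqP ->; lia.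
Qed.

Section Degree.
Variables (T : finType) (e : rel T).
Hypotheses (e_sym : symmetric e) (e_irr : irreflexive e).
Implicit Types (A B H : {set T}) (v w : T).

Definition degree_in A v := #|[set w in A | e v w]|.

(** Twice the number of edges inside [A]; edge counts stay doubled to avoid halves. *)
Definition degree_sum A := \sum_(v in A) degree_in A v.

Lemma degree_inE A v : degree_in A v = \sum_(w in A) e v w.
Proof.
rewrite /degree_in -sum1dep_card big_mkcondr.
by apply: eq_bigr => w _; case: (e v w).
Qed.

Lemma degree_in_subset A B v : A \subset B -> degree_in A v <= degree_in B v.
Proof.
by move=> sAB; apply/subset_leq_card/subsetP=> w;
  rewrite !inE => /andP[/(subsetP sAB)->].
Qed.

Lemma degree_in_leq A v : degree_in A v <= #|A|.
Proof. by apply/subset_leq_card/subsetP=> w; rewrite inE => /andP[]. Qed.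

Lemma degree_in_gt0P A v :
  reflect (exists2 w, w \in A & e v w) (0 < degree_in A v).
Proof.
apply: (iffP card_gt0P) => [[w]|[w wA evw]].
  by rewrite inE => /andP[]; exists w.
by exists w; rewrite inE wA.
Qed.

Lemma degree_inD A H v : A \subset H ->
  degree_in H v = degree_in A v + degree_in (H :\: A) v.
Proof. by move=> sAH; rewrite !degree_inE (big_setID A) /= (setIidPr sAH). Qed.

Lemma degree_sum_set1 v : degree_sum [set v] = 0.
Proof. by rewrite /degree_sum big_set1 degree_inE big_set1 e_irr. Qed.

Lemma degree_sum_subset A B : A \subset B -> degree_sum A <= degree_sum B.
Proof.
move=> sAB; rewrite /degree_sum [X in _ <= X](big_setID A) /= (setIidPr sAB).
apply: leq_trans (leq_addr _ _).
by apply: leq_sum => v _; apply: degree_in_subset.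
Qed.

Lemma degree_sum_exchange A B :
  \sum_(v in A) degree_in B v = \sum_(v in B) degree_in A v.
Proof.
under eq_bigr do rewrite degree_inE.
rewrite exchange_big /=; apply: eq_bigr => v _.
by rewrite degree_inE; apply: eq_bigr => w _; rewrite e_sym.
Qed.

(** An edge inside [A] is counted twice in the sum of degrees over [A], an edge leaving [A] once;
    doubling that sum overcounts by [degree_sum A]. *)
Lemma degree_sumD A H : A \subset H ->
  degree_sum H + degree_sum A =
  degree_sum (H :\: A) + 2 * \sum_(v in A) degree_in H v.
Proof.
move=> sAH.
have inA : \sum_(v in A) degree_in H v =
    degree_sum A + \sum_(v in A) degree_in (H :\: A) v.
  by rewrite /degree_sum -[RHS]big_split; apply: eq_bigr => v _; apply: degree_inD.
have outA : \sum_(v in H :\: A) degree_in H v =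
    \sum_(v in A) degree_in (H :\: A) v + degree_sum (H :\: A).
  by rewrite (degree_sum_exchange A) /degree_sum -[RHS]big_split;
    apply: eq_bigr => v _; apply: degree_inD.
by rewrite {1}/degree_sum (big_setID A) /= (setIidPr sAH) inA outA; lia.
Qed.

Lemma handshake :
  degree_sum [set: T] = #|[set [set p.1; p.2] | p : T * T & e p.1 p.2]| * 2.
Proof.
have -> : degree_sum [set: T] = #|[set p : T * T | e p.1 p.2]|.
  rewrite /degree_sum -sum1dep_card (eq_bigr (fun v => \sum_(w | e v w) 1)); last first.
    by move=> v _; rewrite sum1dep_card; apply: eq_card => w; rewrite !inE.
  rewrite (eq_bigl xpredT) => [|v]; last by rewrite inE.
  by rewrite pair_big_dep.
rewrite -sum1_card.
rewrite (partition_big_imset (fun p : T * T => [set p.1; p.2])) /=.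
rewrite -sum_nat_const.
have -> : [set [set p.1; p.2] | p in [set p : T * T | e p.1 p.2]] =
          [set [set p.1; p.2] | p : T * T & e p.1 p.2].
  by apply: eq_imset => p /=; rewrite ?inE.
apply: eq_bigr => E /imsetP[[v w] /=]; rewrite !inE /= => evw ->.
have nvw : v != w by apply: contraTneq evw => ->; rewrite e_irr.
rewrite sum1dep_card.
transitivity #|[set (v, w); (w, v)]|; last by rewrite cards2 xpair_eqE negb_and nvw.
apply: eq_card => -[x y]; rewrite !inE !xpair_eqE /=.
apply/andP/orP => [[exy /eqP Exy]|].
  have : x \in [set v; w] by rewrite -Exy !inE eqxx.
  have : y \in [set v; w] by rewrite -Exy !inE eqxx orbT.
  have nxy : x != y by apply: contraTneq exy => ->; rewrite e_irr.
  by rewrite !inE => /orP[]/eqP yE /orP[]/eqP xE; move: nxy; rewrite xE yE !eqxx; auto.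
by case=> /andP[/eqP-> /eqP->]; split=> //; [rewrite e_sym | rewrite setUC].
Qed.
End Degree.

Lemma degree_sum_even (T : finType) (e : rel T) (A : {set T}) :
  symmetric e -> irreflexive e -> ~~ odd (degree_sum e A).
Proof.
move=> e_sym e_irr; pose eA := [rel v w | [&& e v w, v \in A & w \in A]].
have eA_sym : symmetric eA by move=> v w /=; rewrite e_sym; case: (v \in A);
  case: (w \in A).
have eA_irr : irreflexive eA by move=> v /=; rewrite e_irr.
suff -> : degree_sum e A = degree_sum eA [set: T] by rewrite (handshake eA_sym) //
  oddM andbF.
rewrite /degree_sum [RHS](big_setID A) /= setTI [X in _ = _ + X]big1 ?addn0 => [|v].
  apply: eq_bigr => v vA; apply: eq_card => w.
  by rewrite !inE /= vA /= andbC.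
rewrite !inE andbT => vA; apply: eq_card0 => w.
by rewrite !inE /= (negPf vA) andbF.
Qed.

(** * Non-adjacency *)

Definition compl_rel (T : eqType) (e : rel T) : rel T :=
  fun v w => (w != v) && ~~ e v w.

Section Complement.
Variables (T : finType) (e : rel T).
Hypotheses (e_sym : symmetric e) (e_irr : irreflexive e).
Implicit Types (A B H : {set T}) (v w : T).

Lemma compl_rel_sym : symmetric (compl_rel e).
Proof. by move=> v w; rewrite /compl_rel eq_sym e_sym. Qed.

Lemma compl_rel_irr : irreflexive (compl_rel e).
Proof. by move=> v; rewrite /compl_rel eqxx. Qed.

Lemma degree_in_compl A v :
  degree_in e A v + degree_in (compl_rel e) A v + (v \in A) = #|A|.
Proof.
rewrite (cardsD1 v A) addnC; congr (_ + _).
rewrite -(cardsID [set w | e v w] (A :\ v)); congr (_ + _); apply: eq_card => w;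
  rewrite !inE /=.
  by case: eqVneq => [->|_]; rewrite ?e_irr ?andbF.
by rewrite /compl_rel; case: (w == v); case: (w \in A); case: (e v w).
Qed.

Lemma degree_sum_compl A :
  degree_sum e A + degree_sum (compl_rel e) A = #|A| * #|A|.-1.
Proof.
rewrite -sum_nat_const /degree_sum -big_split; apply: eq_bigr => v vA /=.
by have := degree_in_compl A v; rewrite vA; lia.
Qed.
End Complement.

(** * Sets without isolated vertices *)

Section NoIsolated.
Variables (T : finType) (d : rel T).
Hypotheses (d_sym : symmetric d) (d_irr : irreflexive d).
Implicit Types (S X Y : {set T}) (v w : T).

(** For [d] the non-adjacency relation and [k.+1] vertices, these are the defective classes. *)
Definition no_isolated S := [forall v in S, 0 < degree_in d S v].

Lemma no_isolatedP S :
  reflect {in S, forall v, exists2 w, w \in S & d v w} (no_isolated S).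
Proof.
by apply: (iffP forall_inP) => noS v /noS /degree_in_gt0P.
Qed.

Lemma no_isolatedU X Y : no_isolated X -> no_isolated Y -> no_isolated (X :|: Y).
Proof.
move=> /no_isolatedP noX /no_isolatedP noY; apply/no_isolatedP => v.
by rewrite inE => /orP[/noX|/noY] [w wXY dvw]; exists w; rewrite // inE wXY ?orbT.
Qed.

Lemma no_isolated_edge v w : d v w -> no_isolated [set v; w].
Proof.
move=> dvw; apply/no_isolatedP => x; rewrite !inE => /orP[]/eqP->.
  by exists w; rewrite // !inE eqxx orbT.
by exists v; rewrite 1?d_sym // !inE eqxx.
Qed.

Lemma no_isolatedU1 X v w : no_isolated X -> w \in X -> d v w -> no_isolated (v |: X).
Proof.
move=> noX wX dvw; rewrite -(setUidPr (_ : [set w] \subset X)) ?sub1set // setUA.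
by apply: no_isolatedU noX; apply: no_isolated_edge.
Qed.

(* If every vertex of [Y] has a neighbour all of whose other neighbours lie
   outside [Y], the private neighbours permute [Y], so [d] is a perfect
   matching on [Y]. *)
Lemma critical_no_isolated_matching Y :
    no_isolated Y -> {in Y, forall y, ~~ no_isolated (Y :\ y)} ->
  {in Y, forall v, degree_in d Y v = 1}.
Proof.
move=> noY crit.
(* [z y] is a vertex that the removal of [y] isolates; by criticality the default is never reached
   for [y] in [Y]. *)
pose z y := odflt y [pick x in Y :\ y | degree_in d (Y :\ y) x == 0].
have zP y : y \in Y -> z y \in Y :\ y /\ degree_in d (Y :\ y) (z y) = 0.
  move=> yY; rewrite /z; case: pickP => [x /andP[? /eqP] //|noz].
  case/negP: (crit y yY); apply/forall_inP => x xY.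
  by rewrite lt0n; have /= := noz x; rewrite xY /= => ->.
have onlyz y w : y \in Y -> w \in Y -> d (z y) w -> w = y.
  move=> yY wY dzw; apply/eqP; apply: contraTT isT => nwy.
  have [_ /eqP] := zP y yY; rewrite eqn0Ngt => /negP[].
  by apply/degree_in_gt0P; exists w; rewrite // !inE nwy.
have z_inj : {in Y &, injective z}.
  move=> y y' yY y'Y eqz.
  have [] := zP y yY; rewrite !inE => /andP[_ zY] _.
  have /degree_in_gt0P[w wY dzw] := forall_inP noY _ zY.
  by rewrite -(onlyz _ _ yY wY dzw) (onlyz y' w) // -eqz.
have zY : z @: Y = Y.
  apply/eqP; rewrite eqEcard card_in_imset // leqnn andbT.
  by apply/subsetP => _ /imsetP[y yY ->]; have [] := zP y yY; rewrite !inE => /andP[].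
move=> v vY; have := vY; rewrite -{1}zY => /imsetP[y yY vE].
apply/eqP; rewrite eqn_leq (forall_inP noY) // andbT -(cards1 y).
apply/subset_leq_card/subsetP => w; rewrite !inE => /andP[wY dvw].
by apply/eqP/(onlyz _ _ yY wY); rewrite -vE.
Qed.

(** If more than [k] vertices are not isolated, take a largest [Y] of at most [k] vertices without
    isolated ones. No edge of [d] joins [Y] to the rest of [X], so some edge [v w] avoids [Y];
    unions of such pieces must miss the size [k.+1]. *)
Lemma no_isolated_free k X : 1 < k ->
    (forall S, S \subset X -> #|S| = k.+1 -> ~~ no_isolated S) ->
  #|[set v in X | 0 < degree_in d X v]| <= k \/
  ~~ odd k /\ {in X, forall v, degree_in d X v <= 1}.
Proof.
move=> k_gt1 freeX; set Z := [set v in X | _].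
have [|ltkZ] := leqP #|Z| k; [by left | right].
have freeX' S : S \subset X -> no_isolated S -> #|S| <> k.+1.
  by move=> sSX noS cS; have := freeX S sSX cS; rewrite noS.
pose P S := [&& S \subset X, no_isolated S & #|S| <= k].
have P0 : P set0 by rewrite /P sub0set cards0 andbT; apply/forall_inP => v; rewrite inE.
case: (arg_maxnP (fun S : {set T} => #|S|) P0) => Y /and3P[sYX noY leYk] maxY.
have grow S : S \subset X -> no_isolated S -> #|S| <= k.+1 -> #|S| <= #|Y|.
  move=> sSX noS; rewrite leq_eqVlt => /orP[/eqP/(freeX' _ sSX noS)//|leSk].
  by apply: maxY; rewrite /P sSX noS -ltnS.
have outY v w : v \in X -> w \in X -> v \notin Y -> d v w -> w \notin Y.
  move=> vX wX vY dvw; apply/negP => wY.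
  have := grow (v |: Y);
    rewrite subUset sub1set vX sYX (no_isolatedU1 noY wY dvw) cardsU1 vY.
  by move=> /(_ isT isT); lia.
have [v vZ vY] : exists2 v, v \in Z & v \notin Y.
  by apply/subsetPn/negP => /subset_leq_card; lia.
have [vX /degree_in_gt0P[w wX dvw]] : v \in X /\ 0 < degree_in d X v.
  by apply/andP; rewrite inE in vZ.
have wY := outY _ _ vX wX vY dvw.
have nvw : v != w by apply: contraTneq dvw => ->; rewrite d_irr.
have addvw S : S \subset Y -> #|S :|: [set v; w]| = #|S| + 2.
  move=> sSY; rewrite cardsU cards2 nvw.
  suff -> : S :&: [set v; w] = set0 by rewrite cards0 subn0.
  apply/setP => x; rewrite !inE; apply/negP => /andP[/(subsetP sSY) xY].
  by move=> /orP[]/eqP xE; move: xY; rewrite xE (negPf vY, negPf wY).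
have svwX : [set v; w] \subset X by rewrite subUset !sub1set vX wX.
have cY : #|Y| = k.
  have := grow (Y :|: [set v; w]).
  rewrite subUset sYX svwX no_isolatedU ?no_isolated_edge // addvw //.
  by move=> /(_ isT isT); lia.
(* If some [Y :\ y] had no isolated vertex, adding [v] and [w] would give the forbidden size [k.+1];
   hence [Y] is critical. *)
have Ymatch : {in Y, forall y, degree_in d Y y = 1}.
  apply: critical_no_isolated_matching noY _ => y yY; apply/negP => noYy.
  have sYyY : Y :\ y \subset Y by apply: subsetDl.
  apply: (freeX' ((Y :\ y) :|: [set v; w])).
  - by rewrite subUset svwX andbT (subset_trans sYyY).
  - by rewrite no_isolatedU ?no_isolated_edge.
  - by rewrite addvw // -cY (cardsD1 y Y) yY addn2.
split.
  have := degree_sum_even Y d_sym d_irr.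
  by rewrite /degree_sum (eq_bigr (fun=> 1) Ymatch) sum1_card cY.
move=> a aX; rewrite leqNgt; apply/negP => /card_gt1P[b [c []]].
rewrite !inE => /andP[bX dab] /andP[cX dac] nbc.
have aY : a \notin Y.
  apply/negP => aY.
  have inY x : x \in X -> d a x -> x \in Y.
    by move=> xX dax; apply: contraTT aY => xY; apply: (outY x) => //; rewrite d_sym.
  suff : 1 < degree_in d Y a by rewrite Ymatch.
  by apply/card_gt1P; exists b, c; rewrite !inE !inY.
have [bY cY'] := (outY a b aX bX aY dab, outY a c aX cX aY dac).
have nab : a != b by apply: contraTneq dab => ->; rewrite d_irr.
have nac : a != c by apply: contraTneq dac => ->; rewrite d_irr.
have /card_gt0P[y yY] : 0 < #|Y| by rewrite cY ltnW.
have /degree_in_gt0P[y' y'Y dyy'] := forall_inP noY _ yY.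
have nyy' : y != y' by apply: contraTneq dyy' => ->; rewrite d_irr.
(* One matching edge [y y'] of [Y] is traded for the path [b a c], giving size [k - 2 + 3]. *)
pose Y2 := Y :\: [set y; y'].
have cY2 : #|Y2| = k - 2.
  by rewrite cardsD (setIidPr _) ?subUset ?sub1set ?yY // cards2 nyy' cY.
have match1 x x' : x \in Y -> x' \in Y -> d x x' -> forall u, u \in Y -> d x u -> u
  = x'.
  move=> xY x'Y dxx' u uY dxu; apply/eqP; apply: contraTT isT => nux.
  suff : 1 < degree_in d Y x by rewrite Ymatch.
  by apply/card_gt1P; exists u, x'; rewrite !inE uY x'Y.
have noY2 : no_isolated Y2.
  apply/no_isolatedP => x; rewrite !inE negb_or => /andP[/andP[nxy nxy'] xY].
  have /degree_in_gt0P[u uY dxu] := forall_inP noY _ xY.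
  exists u => //; rewrite !inE uY andbT negb_or; apply/andP; split.
    apply: contra nxy' => /eqP uE; rewrite uE d_sym in dxu.
    by rewrite (match1 y y' _ _ _ x).
  apply: contra nxy => /eqP uE; rewrite uE d_sym in dxu.
  by rewrite (match1 y' y _ _ _ x) // d_sym.
have no3 : no_isolated (c |: [set a; b]).
  by apply: (@no_isolatedU1 _ _ a); rewrite ?no_isolated_edge ?set21 // d_sym.
apply: (freeX' (Y2 :|: (c |: [set a; b]))).
- rewrite !subUset !sub1set aX bX cX !andbT.
  by rewrite (subset_trans _ sYX) ?subsetDl.
- exact: no_isolatedU.
rewrite cardsU cardsU1 cards2 nab !inE eq_sym (negPf nac) eq_sym (negPf nbc) cY2.
suff -> : Y2 :&: (c |: [set a; b]) = set0 by rewrite cards0 /= subn0 -subSS subnK.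
apply/setP => x; rewrite !inE; apply/negP => /andP[/andP[_ xY]] /or3P[]/eqP xE;
  by move: xY; rewrite xE ?(negPf aY) ?(negPf bY) ?(negPf cY').
Qed.
End NoIsolated.

(** * Splitting into classes of small degree *)

Section Splitting.
Variables (T : finType) (e : rel T) (k : nat).
Hypotheses (e_sym : symmetric e) (e_irr : irreflexive e) (k_gt0 : 0 < k).
Implicit Types (A B H : {set T}) (v w : T).

Definition splits q H := exists2 f : T -> nat,
  {in H, forall v, f v < q} &
  {in H, forall v, #|[set w in H | e v w & f w == f v]| < k}.

Lemma splits_class q A H : {in A, forall v, degree_in e A v < k} ->
  splits q (H :\: A) -> splits q.+1 H.
Proof.
move=> degA [f fq fk]; pose g v := if v \in A then q else f v.
exists g => v vH; rewrite /g; case: ifPn => vA //.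
- by rewrite ltnS ltnW // fq // inE vA.
- apply: leq_ltn_trans (degA v vA); apply/subset_leq_card/subsetP => w.
  rewrite !inE => /and3P[wH -> ]; case: ifPn => //= wA /eqP fw.
  by have := fq w; rewrite !inE wA wH fw ltnn => /(_ isT).
- have vHA : v \in H :\: A by rewrite inE vA.
  apply: leq_ltn_trans (fk v vHA); apply/subset_leq_card/subsetP => w.
  rewrite !inE => /and3P[-> ->]; case: ifPn => //= wA /eqP qE.
  by have := fq v vHA; rewrite -qE ltnn.
Qed.

(** Any [k] vertices form an admissible class, as degrees among them are below [k]; [A] is cut into
    [i] pieces of at most this size. *)
Lemma splits_setD q i A H :
  #|A| <= k * i -> splits q (H :\: A) -> splits (q + i) H.
Proof.
elim: i A H => [|i IHi] A H leA.
  have -> : A = set0 by apply/eqP; rewrite -cards_eq0; lia.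
  by rewrite setD0 addn0.
have [B sBA cB] : exists2 B : {set T}, B \subset A & #|B| = minn k #|A|.
  by apply: ex_subset_card; exact: geq_minr.
have cAB : #|A :\: B| <= k * i by rewrite cardsD (setIidPr sBA); lia.
rewrite addnS => spl; apply: (@splits_class _ B).
  move=> v vB; apply: (@leq_trans #|B|); last by rewrite cB geq_minl.
  apply/proper_card/properP; split; first by apply/subsetP=> w; rewrite inE => /andP[].
  by exists v; rewrite // inE e_irr andbF.
apply: IHi cAB _; suff -> : H :\: B :\: (A :\: B) = H :\: A by [].
apply/setP => x; rewrite !inE; case xB: (x \in B) => //=.
by rewrite (subsetP sBA) ?xB.
Qed.

(* Lovász: in a partition into [q] classes minimising the number of inner
   edges, no vertex would gain by moving to another class. *)
Lemma splits_of_max_degree q H :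
  {in H, forall v, degree_in e H v < k * q} -> splits q H.
Proof.
case: q => [|q] degH.
  by exists (fun=> 0) => v /degH; rewrite muln0.
pose eF (f : {ffun T -> 'I_q.+1}) v w := e v w && (f w == f v).
have eF_sym f : symmetric (eF f) by move=> v w; rewrite /eF e_sym eq_sym.
have eF_irr f : irreflexive (eF f) by move=> v; rewrite /eF e_irr.
have [f _ minf] := arg_minnP (fun f => degree_sum (eF f) H) (erefl (predT [ffun=>
  ord0])).
exists (fun v => val (f v : 'I_q.+1)) => v vH; first exact: ltn_ord.
change (degree_in (eF f) H v < k); rewrite ltnNge; apply/negP => gek.
(* Not every class can hold [k] neighbours of [v], whose degree is below [k * q.+1]. Moving [v] to
   class [j] then lowers the number of inner edges. *)
have [j ltjk] : exists j : 'I_q.+1, #|[set w in H | e v w & f w == j]| < k.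
  apply/existsP/contraT; rewrite negb_exists => /forallP /= big.
  have := degH v vH; rewrite ltnNge => /negP[].
  rewrite mulnC -[q.+1]card_ord -sum_nat_const.
  rewrite /degree_in -sum1_card (partition_big f xpredT) //=.
  apply: leq_sum => j _; rewrite leqNgt; apply: contra (big j).
  rewrite sum1dep_card; congr (_ < _); apply: eq_card => w.
  by rewrite !inE andbA.
pose g := [ffun w => if w == v then j else f w].
have /= := minf g isT; apply/negP; rewrite -ltnNge.
have svH : [set v] \subset H by rewrite sub1set.
have := degree_sumD (eF_sym f) svH; have := degree_sumD (eF_sym g) svH.
rewrite !big_set1 !degree_sum_set1 //.
have -> : degree_sum (eF g) (H :\ v) = degree_sum (eF f) (H :\ v).
  apply: eq_bigr => x; rewrite !inE => /andP[nxv _]; apply: eq_card => w.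
  by rewrite !inE /eF !ffunE (negPf nxv); case: eqVneq.
have : degree_in (eF g) H v < k.
  apply: leq_ltn_trans ltjk; apply/subset_leq_card/subsetP => w.
  rewrite !inE /eF !ffunE eqxx => /and3P[-> evw /=].
  case: (eqVneq w v) => [wv|_ ->]; last by rewrite evw.
  by rewrite wv e_irr in evw.
lia.
Qed.

Lemma ex_large_degree q H : ~ splits q H ->
  exists2 v, v \in H & k * q <= degree_in e H v.
Proof.
move=> nospl; apply/exists_inP/contraT; rewrite negb_exists_in => /forall_inP noH.
by case: nospl; apply: splits_of_max_degree => v /noH; rewrite -ltnNge.
Qed.

(** Fewer than [q] neighbours of [v] leave some class free of them, and [v] joins it. *)
Lemma splits_setD1 q v H :
  degree_in e H v < q -> splits q (H :\ v) -> splits q H.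
Proof.
move=> degv [f fq fk].
have [j ltjq jN] : exists2 j, j < q & j \notin [seq f w | w in [set w in H | e v w]].
  suff : ~~ all [in [seq f w | w in [set w in H | e v w]]] (iota 0 q).
    by case/allPn => j; rewrite mem_iota; exists j.
  apply/negP => /allP sub; have := uniq_leq_size (iota_uniq 0 q) sub.
  by rewrite size_iota size_image leqNgt degv.
have jP w : w \in H -> e v w -> f w != j.
  move=> wH evw; apply: contraNneq jN => <-; apply/imageP; exists w => //.
  by rewrite inE wH.
pose g w := if w == v then j else f w.
exists g => w wH; rewrite /g; case: eqVneq => [wv|nwv] //.
- by apply: fq; rewrite !inE nwv.
- rewrite eq_card0 // => x; rewrite !inE; apply/negP => /and3P[xH ewx].
  case: (eqVneq x v) => [xv|_]; first by rewrite wv xv e_irr in ewx.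
  by apply/negP; rewrite jP // -wv.
- have wHv : w \in H :\ v by rewrite !inE nwv.
  apply: leq_ltn_trans (fk w wHv); apply/subset_leq_card/subsetP => x.
  rewrite !inE => /and3P[xH ewx]; case: (eqVneq x v) => [xv /eqP jE|_ ->];
    last by rewrite ewx xH.
  by move: (jP w wH); rewrite e_sym -xv ewx jE eqxx => /(_ isT).
Qed.

Lemma ex_min_degree q H : ~ splits q H ->
  exists H', [/\ H' \subset H, ~ splits q H' & {in H', forall v, q <= degree_in e
    H' v}].
Proof.
have [m leHm] := ubnP #|H|; elim: m H leHm => // m IHm H leHm nospl.
have [degH|] := boolP [forall v in H, q <= degree_in e H v].
  by exists H; split=> //; apply/forall_inP.
rewrite negb_forall_in => /exists_inP[v vH]; rewrite -ltnNge => degv.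
have [||H' [sH' noH' degH']] := IHm (H :\ v).
- by have := cardsD1 v H; rewrite vH; lia.
- by move/(splits_setD1 degv).
by exists H'; split=> //; apply: subset_trans sH' (subsetDl _ _).
Qed.

(** Each round removes [k] vertices one by one. The first has degree at least [k * q.+1], the later
    ones at least [k * q], since all those removed before them fit into a single class. *)
Lemma degree_sum_geq_greedy q H : ~ splits q H ->
  (k * q) ^ 2 + k * q <= degree_sum e H + q * (k * (k - 1)).
Proof.
elim: q H => [|q IHq] H nospl; first by rewrite muln0.
have greedy j : j < k -> exists W : {set T}, [/\ W \subset H, #|W| = j.+1 &
    degree_sum e (H :\: W) + 2 * (k * q.+1) + 2 * (j * (k * q)) <= degree_sum e H].
  elim: j => [|j IHj] ltjk.
    have [v vH degv] := ex_large_degree nospl; exists [set v].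
    have svH : [set v] \subset H by rewrite sub1set.
    split; rewrite ?cards1 //.
    by have := degree_sumD e_sym svH; rewrite big_set1 degree_sum_set1 //; lia.
  have [W [sWH cW sumW]] := IHj (ltnW ltjk).
  have nosplW : ~ splits q (H :\: W).
    by move=> spl; apply: nospl; rewrite -addn1; apply: splits_setD spl;
      rewrite cW muln1 ltnW.
  have [v vHW degv] := ex_large_degree nosplW; exists (v |: W).
  have := vHW; rewrite inE => /andP[vW vH].
  split; first by rewrite subUset sub1set vH.
    by rewrite cardsU1 vW cW.
  have svH : [set v] \subset H :\: W by rewrite sub1set.
  have := degree_sumD e_sym svH; rewrite big_set1 degree_sum_set1 //.
  by rewrite setDDl setUC mulSn; lia.
have ltk1 : k.-1 < k by rewrite prednK.
have [W [sWH cW sumW]] := greedy _ ltk1; rewrite prednK // in cW.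
have nosplW : ~ splits q (H :\: W).
  by move=> spl; apply: nospl; rewrite -addn1; apply: splits_setD spl; rewrite cW muln1.
have := IHq _ nosplW; move: sumW; case: (k) k_gt0 => // j _ /=.
by rewrite subn1 -!mulnn /=; lia.
Qed.
End Splitting.

(** * Lower bound on the number of edges *)

(* In a matching on [X] the ends of edges can be added two by two, so that at
   most one vertex of [W] has its partner outside [W]. *)
Lemma matching_subset (T : finType) (d : rel T) (X : {set T}) k :
    symmetric d -> irreflexive d -> k <= #|X| ->
    {in X, forall v, degree_in d X v <= 1} ->
  exists W : {set T}, [/\ W \subset X, #|W| = k &
    2 * \sum_(v in W) degree_in d X v <= degree_sum d W + k.+1].
Proof.
move=> d_sym d_irr lekX matchX.
suff [W [sWX cW [B leB outB]]] : exists W : {set T}, [/\ W \subset X, #|W| = k &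
    exists2 B : {set T}, #|B| <= 1 &
      {in W, forall v, v \notin B -> degree_in d W v = degree_in d X v}].
  exists W; split=> //; rewrite big_distrr /=.
  have le1 : \sum_(v in W) (v \in B) <= 1.
    rewrite -big_mkcondr sum1dep_card; apply: leq_trans leB.
    by apply/subset_leq_card/subsetP => v; rewrite inE => /andP[].
  have -> : degree_sum d W + k.+1 = degree_sum d W + \sum_(v in W) 1 + 1.
    by rewrite sum1_card cW addn1 addnS.
  apply: leq_trans (leq_add (leqnn _) le1).
  rewrite /degree_sum -!big_split; apply: leq_sum => v vW /=.
  have := matchX v (subsetP sWX v vW).
  by case: (v \in B) (outB v vW) => [_|->] //; lia.
elim: k lekX => [|j IHj] ltjX.
  exists set0; rewrite sub0set cards0; split=> //.
  by exists set0 => [|v]; rewrite ?cards0 ?inE.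
have [W [sWX cW [B leB outB]]] := IHj (ltnW ltjX).
have grow y w : w \in W -> degree_in d W w = degree_in d X w -> y \in X ->
    degree_in d (y |: W) w = degree_in d X w.
  move=> wW eqw yX; apply/eqP; rewrite eqn_leq -{2}eqw !degree_in_subset ?subsetU1 //.
  by rewrite subUset sub1set yX.
have addy y : y \in X -> y \notin W -> y |: W \subset X /\ #|y |: W| = j.+1.
  by move=> yX yW; rewrite subUset sub1set yX sWX cardsU1 yW cW.
(* If [W] separates no matched pair, any new [y] will do and becomes the exception; otherwise the
   missing partner of the exception [x] is added. *)
have [full|] := boolP [forall v in W, degree_in d W v == degree_in d X v].
  have [y yX yW] : exists2 y, y \in X & y \notin W.
    by apply/subsetPn/negP => /subset_leq_card; rewrite cW leqNgt ltjX.
  have [sX cX] := addy y yX yW; exists (y |: W); split=> //.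
  exists [set y]; rewrite ?cards1 // => v; rewrite !inE => /orP[->//|vW] _.
  by apply: grow => //; apply/eqP/(forall_inP full).
rewrite negb_forall_in => /exists_inP[x xW neqx].
have xB : x \in B by apply: contraR neqx => /outB->.
have [y yX /andP[yW dxy]] : exists2 y, y \in X & (y \notin W) && d x y.
  apply/exists_inP; apply: contraR neqx; rewrite negb_exists_in => /forall_inP noy.
  apply/eqP/eq_card => w; rewrite !inE; case dxw: (d x w); rewrite ?andbF // !andbT.
  apply/idP/idP => [/(subsetP sWX)//|wX].
  by have := noy w wX; rewrite dxw andbT negbK.
have [sX cX] := addy y yX yW; exists (y |: W); split=> //.
have gt0eq v : v \in X -> 0 < degree_in d (y |: W) v ->
    degree_in d (y |: W) v = degree_in d X v.
  move=> vX gt0; apply/eqP; rewrite eqn_leq degree_in_subset //=.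
  exact: leq_trans (matchX v vX) gt0.
exists set0; rewrite ?cards0 // => v + _; rewrite !inE => /orP[/eqP->|vW].
  apply: gt0eq => //; apply/degree_in_gt0P; exists x; rewrite 1?d_sym //.
  by rewrite !inE xW orbT.
have [->|nvx] := eqVneq v x.
  apply: gt0eq; first exact: (subsetP sWX).
  by apply/degree_in_gt0P; exists y; rewrite // !inE eqxx.
apply: grow => //; apply: outB => //; apply: contra nvx => vB.
by apply/eqP/(card_le1_eqP leB).
Qed.

(** * Descent in the number of classes *)

Section Descent.
Variables (T : finType) (e : rel T) (k : nat).
Hypotheses (e_sym : symmetric e) (e_irr : irreflexive e) (k_gt1 : 1 < k).
Implicit Types (A B H S W X : {set T}) (v w y : T).
Let d := compl_rel e.
Let d_sym : symmetric d := compl_rel_sym e_sym.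
Let d_irr : irreflexive d := compl_rel_irr e.
Let k_gt0 : 0 < k := ltnW k_gt1.

Lemma splits_no_isolated q H S : #|S| = k.+1 -> no_isolated d S ->
  splits e k q (H :\: S) -> splits e k q.+1 H.
Proof.
move=> cS /forall_inP noS; apply: splits_class => v vS.
by have := degree_in_compl e_irr S v; have := noS v vS; rewrite cS vS /d; lia.
Qed.

(** As [A] fills at most [i] classes, some [y] has degree at least [k * q] outside [A]; inside [A]
    it misses only [degree_in d A y] vertices. *)
Lemma ex_large_degree_outside q i A H : ~ splits e k (q + i) H ->
    A \subset H -> #|A| <= k * i ->
  exists2 y, y \in H :\: A &
    k * q + #|A| <= degree_in e H y + degree_in d A y.
Proof.
move=> nospl sAH leA.
have [|y yHA degy] := @ex_large_degree _ e k e_sym e_irr k_gt0 q (H :\: A).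
  by move=> spl; apply: nospl; apply: splits_setD spl.
exists y => //; have := degree_in_compl e_irr A y.
by rewrite (degree_inD e y sAH); move: yHA; rewrite inE => /andP[/negPf-> _];
  rewrite -/d; lia.
Qed.

Lemma degree_sum_no_isolated S : #|S| = k.+1 -> no_isolated d S ->
  degree_sum e S + k.+1 <= k.+1 * k.
Proof.
move=> cS /forall_inP noS; have := degree_sum_compl e_irr S; rewrite cS /= => <-.
rewrite leq_add2l -{1}cS -sum1_card; apply: leq_sum => v /noS; by [].
Qed.

(* Starting from the set of all vertices of degree at least [k * q.+1 - 2 * k],
   repeatedly discard the vertices violating the last condition; the set stays
   larger than [2 * k] because every [2 * k]-subset [A] leaves outside it a
   vertex [y] as in [clos], which is never discarded. *)
Lemma large_degree_core q H : 0 < q -> ~ splits e k q.+1 H ->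
  exists X, [/\ X \subset [set v in H | k * q.+1 <= degree_in e H v + 2 * k],
    2 * k < #|X| & {in X, forall v, k * q.+1 <= degree_in e H v + degree_in d X v}].
Proof.
move=> q_gt0 nospl; set X0 := [set v in H | _].
pose clos X := [forall y in H, forall A : {set T}, (A \subset X) ==> (#|A| == 2 * k) ==>
  (k * q.+1 <= degree_in e H y + degree_in d A y) ==> (y \in X)].
have closP X : reflect (forall y A, y \in H -> A \subset X -> #|A| = 2 * k ->
    k * q.+1 <= degree_in e H y + degree_in d A y -> y \in X) (clos X).
  apply: (iffP forall_inP) => [clX y A yH sAX /eqP cA|clX y yH].
    by have /forallP/(_ A)/implyP/(_ sAX)/implyP/(_ cA)/implyP := clX y yH.
  apply/forallP => A; apply/implyP => sAX; apply/implyP => /eqP cA; apply/implyP.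
  exact: clX yH sAX cA.
have outside A : A \subset H -> #|A| <= 2 * k -> exists2 y, y \in H :\: A &
    k * q.+1 + #|A| <= degree_in e H y + degree_in d A y + 2 * k.
  move=> sAH leA; have nospl2 : ~ splits e k (q.-1 + 2) H by rewrite addn2 prednK.
  have [|y yHA degy] := ex_large_degree_outside nospl2 sAH; first by rewrite mulnC.
  by exists y => //; case: (q) q_gt0 degy => //= j _; rewrite !mulnS; lia.
have sX0H : X0 \subset H by apply/subsetP => v; rewrite inE => /andP[].
pose P X := (2 * k < #|X|) && clos X.
have PX0 : P X0.
  apply/andP; split.
    rewrite ltnNge; apply/negP => leX0; have [y] := outside _ sX0H leX0.
    rewrite !inE negb_and => /andP[/orP[/negPf->|/negP ltdeg] yH] // degy; apply: ltdeg.
    by have := degree_in_leq d X0 y; lia.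
  apply/closP => y A yH sA cA degy; rewrite inE yH.
  by apply: leq_trans degy _; rewrite leq_add2l -cA degree_in_leq.
(* A minimal set satisfying [P] replaces the repeated discarding: once [X'] is shown to satisfy [P],
   it is all of [X]. *)
have [X /minsetP[/andP[gtX /closP clX] minX] sXX0] := minset_exists PX0.
exists X; split=> // v vX.
pose X' := [set v in X | k * q.+1 <= degree_in e H v + degree_in d X v].
have sX'X : X' \subset X by apply/subsetP => w; rewrite inE => /andP[].
suff : P X'.
  by move=> PX'; have := vX; rewrite -{1}(minX X' PX' sX'X) inE => /andP[].
have sXH := subset_trans sXX0 sX0H.
have inX' y A : y \in H -> A \subset X -> #|A| = 2 * k ->
    k * q.+1 <= degree_in e H y + degree_in d A y -> y \in X'.
  move=> yH sAX cA degy; rewrite inE (clX y A) //.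
  by apply: leq_trans degy _; rewrite leq_add2l degree_in_subset.
apply/andP; split; last first.
  by apply/closP => y A yH sAX'; apply: inX' => //; apply: subset_trans sX'X.
rewrite ltnNge; apply/negP => leX'.
have [|A [sX'A sAX cA]] := @ex_between_card _ X X' (2 * k) sX'X;
  first by rewrite leX' ltnW.
have [||y] := outside A; [exact: subset_trans sXH | by rewrite cA |].
rewrite inE cA leq_add2r => /andP[yA yH] degy.
by case/negP: yA; apply: (subsetP sX'A); apply: inX' degy.
Qed.

(** The gain is the increment of [(k * q) ^ 2 + odd k * (k * q)] from [q] to [q.+1]. It comes from
    removing a defective class in [X0] or, if there is none, [k] vertices of [X] chosen according to
    [no_isolated_free]. *)
Lemma splits_descent q H : 2 * k + 2 <= q -> ~ splits e k q.+1 H ->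
  exists2 H', ~ splits e k q H' &
    degree_sum e H' + k * k * (2 * q + 1) + odd k * k <= degree_sum e H.
Proof.
move=> leq nospl; have q_gt0 : 0 < q by lia.
have [X [sXX0 gtX degX]] := large_degree_core q_gt0 nospl.
set X0 := [set v in H | _] in sXX0.
have sX0H : X0 \subset H by apply/subsetP => v; rewrite inE => /andP[].
have [/existsP[S /and3P[sSX0 /eqP cS noS]]|] :=
    boolP [exists S : {set T}, [&& S \subset X0, #|S| == k.+1 & no_isolated d S]].
  exists (H :\: S); first by move/(splits_no_isolated cS noS).
  have := degree_sumD e_sym (subset_trans sSX0 sX0H).
  have := degree_sum_no_isolated cS noS.
  have : k.+1 * (k * q.+1) <= \sum_(v in S) degree_in e H v + k.+1 * (2 * k).
    rewrite -cS -!sum_nat_const -big_split; apply: leq_sum => v /(subsetP sSX0).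
    by rewrite inE => /andP[].
  set sm := \sum_(v in S) _.
  (* The extra vertex of [S] brings in [2 * k * q], which has to outweigh at most
     [4 * k * k + 3 * k - 1]. *)
  have : k * (2 * k + 2) <= k * q by rewrite leq_mul2l leq orbT.
  case: (odd k); lia.
rewrite negb_exists => /forallP noS.
have sXH := subset_trans sXX0 sX0H.
have removal W : W \subset X -> #|W| = k ->
    k * (k * q.+1) <= \sum_(v in W) degree_in e H v + \sum_(v in W) degree_in d X v.
  move=> sWX cW; rewrite -{1}cW -sum_nat_const -big_split.
  by apply: leq_sum => v /(subsetP sWX)/degX.
have nosplW W : #|W| = k -> ~ splits e k q (H :\: W).
  by move=> cW spl; apply: nospl; rewrite -addn1; apply: splits_setD spl;
    rewrite ?cW ?muln1.
have [|small|[evenk matchX]] := @no_isolated_free _ d d_sym d_irr k X k_gt1.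
- move=> S sSX cS; have := noS S; rewrite cS eqxx /= !negb_and.
  by rewrite (subset_trans sSX sXX0).
(* More than [2 * k] vertices minus at most [k] leave [k] that miss nothing in [X]; by [degX] their
   degrees are at least [k * q.+1]. *)
- have [|W sW cW] := @ex_subset_card _ (X :\: [set v in X | 0 < degree_in d X v]) k.
    rewrite cardsD (setIidPr _); last by apply/subsetP => v; rewrite inE => /andP[].
    by lia.
  have sWX := subset_trans sW (subsetDl _ _).
  exists (H :\: W); first exact: nosplW.
  have := removal W sWX cW; rewrite [X in _ <= _ + X]big1 ?addn0; last first.
    move=> v /(subsetP sW); rewrite !inE negb_and -eqn0Ngt.
    by case: (v \in X) => //= /andP[/eqP].
  have := degree_sumD e_sym (subset_trans sWX sXH).
  have := degree_sum_compl e_irr W; rewrite cW.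
  set sm := \sum_(v in W) _; case: (k) k_gt1 => // j _ /=.
  case: (odd j); lia.
have [|W [sWX cW sumW]] := @matching_subset _ d X k d_sym d_irr _ matchX; first by lia.
exists (H :\: W); first exact: nosplW.
have := removal W sWX cW.
have := degree_sumD e_sym (subset_trans sWX sXH).
have := degree_sum_compl e_irr W; rewrite cW -/d.
(* The estimate falls short by [1]; parity makes up for it, as both degree sums and [k] are even. *)
have := degree_sum_even H e_sym e_irr; have := degree_sum_even (H :\: W) e_sym e_irr.
move: sumW; set s1 := \sum_(v in W) degree_in d X v; set s2 := \sum_(v in W) _.
rewrite (negPf evenk) mul0n addn0.
have [j ->] : exists j, k = 2 * j by exists k./2; lia.
case: j => [|j] /=; first by lia.
lia.
Qed.

(** Greedy deletion gives the bound at [2 * k + 2] classes, and the descent carries its deficit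
    unchanged to every larger [q]. *)
Lemma degree_sum_geq q H : 2 * k + 2 <= q -> ~ splits e k q H ->
  (k * q) ^ 2 + odd k * (k * q) <= degree_sum e H + (2 * k + 2) * (k * (k - 1)).
Proof.
move=> leq; rewrite -(subnKC leq); elim: (q - _) H => [|i IHi] H.
  rewrite addn0 => /(degree_sum_geq_greedy e_sym e_irr k_gt0).
  by case: (odd k); lia.
rewrite addnS => nospl; have [|H' /IHi leH' leH] := splits_descent _ nospl.
  exact: leq_addr.
move: leH leH'; rewrite -!mulnn; case: (odd k); lia.
Qed.

Lemma degree_sum_remove_no_isolated q H S : 2 * k + 2 <= q ->
    ~ splits e k q.+1 H -> S \subset H -> #|S| = k.+1 -> no_isolated d S ->
  (k * q) ^ 2 + odd k * (k * q) + 2 * \sum_(v in S) degree_in e H v <=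
  degree_sum e H + degree_sum e S + (2 * k + 2) * (k * (k - 1)).
Proof.
move=> leq nospl sSH cS noS.
have /(degree_sum_geq leq) : ~ splits e k q (H :\: S).
  by move/(splits_no_isolated cS noS).
by have := degree_sumD e_sym sSH; lia.
Qed.

(** The missing edges lie within [k] vertices or, for even [k], form a matching on [k * q + 1]
    vertices, whence the slack [1]. In the first case with [k] even, [k <= q] bounds the loss. *)
Lemma degree_sum_dense q X : #|X| = k * q + 1 -> k <= q ->
    (forall S, S \subset X -> #|S| = k.+1 -> ~~ no_isolated d S) ->
  (k * q) ^ 2 + odd k * (k * q) <=
  degree_sum e X + (if odd k then k * (k - 1) else 1).
Proof.
move=> cX lekq freeX.
have := degree_sum_compl e_irr X; rewrite -/d cX addn1 /= -mulnn.
have [small|[evenk matchX]] := no_isolated_free d_sym d_irr k_gt1 freeX; last first.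
  have : degree_sum d X <= #|X|.
    by rewrite -sum1_card; apply: leq_sum => v /matchX.
  by rewrite cX (negPf evenk) mul0n; lia.
set Z := [set v in X | _] in small.
have : degree_sum d X <= k * (k - 1).
  have sZX : Z \subset X by apply/subsetP => v; rewrite inE => /andP[].
  rewrite /degree_sum (big_setID Z) /= (setIidPr sZX) [X in _ + X]big1 ?addn0 => [|v].
    apply: leq_trans (leq_mul small (leqnn _)); rewrite -sum_nat_const.
    apply: leq_sum => v vZ; apply: (@leq_trans #|Z :\ v|).
      apply/subset_leq_card/subsetP => w; rewrite !inE => /andP[wX dvw].
      rewrite wX; apply/andP; split; first by apply: contraTneq dvw => ->;
        rewrite d_irr.
      have := vZ; rewrite inE => /andP[vX _].
      by apply/degree_in_gt0P; exists v; rewrite // d_sym.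
    by have := cardsD1 v Z; rewrite vZ; lia.
  by rewrite !inE negb_and -eqn0Ngt => /andP[/orP[/negPf->|/eqP->]].
have : k * k <= k * q by rewrite leq_mul2l lekq orbT.
by case: (odd k); lia.
Qed.

Lemma degree_sum_geq_sharp q H : k ^ 3 + 2 * k ^ 2 + 2 * k <= q.+1 ->
    ~ splits e k q H ->
  (k * q) ^ 2 + odd k * (k * q) <=
  degree_sum e H + (if odd k then k * (k - 1) else 1).
Proof.
move=> leq nospl0; have [H' [sH'H nospl degH]] := ex_min_degree e_sym e_irr k_gt0
  nospl0.
apply: leq_trans (leq_add (degree_sum_subset e sH'H) (leqnn _)) => {H nospl0 sH'H}.
move: H' nospl degH => H nospl degH; rewrite leqNgt; apply/negP => small.
have leq' : 2 * k ^ 3 + 4 * k ^ 2 + 4 * k <= 2 * q.+1 by lia.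
rewrite -!mulnn (expnS k 2) -mulnn in leq small leq'.
case: q leq small leq' nospl degH => [|q] leq small leq' nospl degH; first by nia.
have lekq : k * k + 2 * k + 2 <= q by nia.
have leq2k : 2 * k + 2 <= q by lia.
pose X := [set v in H | k * q.+1 <= degree_in e H v + 2 * k].
have sXH : X \subset H by apply/subsetP => v; rewrite inE => /andP[].
have freeX S : S \subset X -> #|S| = k.+1 -> ~~ no_isolated d S.
  move=> sSX cS; apply/negP => noS.
  have := degree_sum_remove_no_isolated leq2k nospl (subset_trans sSX sXH) cS noS.
  have := degree_sum_no_isolated cS noS.
  have : k.+1 * (k * q.+1) <= \sum_(v in S) degree_in e H v + k.+1 * (2 * k).
    rewrite -cS -!sum_nat_const -big_split; apply: leq_sum => v /(subsetP sSX).
    by rewrite inE => /andP[].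
  set sm := \sum_(v in S) _; rewrite -mulnn.
  have : k * (k * k + 2 * k + 2) <= k * q by rewrite leq_mul2l lekq orbT.
  move: small; case: (odd k); lia.
(* Otherwise [u] and [k] of its non-neighbours in [X] form a defective class. For [u] only the
   degree bound [q.+1] is known; twice this must outweigh a deficit of order [2 * k ^ 3], hence the
   cubic hypothesis. *)
have codegX u : u \in H -> degree_in d X u < k.
  move=> uH; rewrite ltnNge; apply/negP => /ex_subset_card[L sL cL].
  have sLX : L \subset X by apply: subset_trans sL _; apply/subsetP => w;
    rewrite inE => /andP[].
  have dL w : w \in L -> d u w by move/(subsetP sL); rewrite inE => /andP[].
  have uL : u \notin L by apply/negP => /dL; rewrite d_irr.
  have cS : #|u |: L| = k.+1 by rewrite cardsU1 uL cL.
  have noS : no_isolated d (u |: L).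
    apply/no_isolatedP => w; rewrite !inE => /orP[/eqP->|wL].
      have /card_gt0P[x xL] : 0 < #|L| by rewrite cL.
      by exists x; rewrite ?dL // inE xL orbT.
    by exists u; rewrite 1?d_sym ?dL // !inE eqxx.
  have sSH : u |: L \subset H by rewrite subUset sub1set uH (subset_trans sLX).
  have := degree_sum_remove_no_isolated leq2k nospl sSH cS noS.
  have : degree_sum e (u |: L) <= k * (k - 1).
    have := degree_sum_compl e_irr (u |: L); rewrite cS -/d /=.
    have : k + k <= degree_sum d (u |: L).
      rewrite /degree_sum big_setU1 //=; apply: leq_add.
        rewrite -cL; apply/subset_leq_card/subsetP => w wL.
        by rewrite !inE wL orbT dL.
      rewrite -{1}cL -sum1_card; apply: leq_sum => w wL.
      by apply/degree_in_gt0P; exists u; rewrite 1?d_sym ?dL // !inE eqxx.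
    lia.
  rewrite big_setU1 //=.
  have : k * (k * q.+1) <= \sum_(v in L) degree_in e H v + k * (2 * k).
    rewrite -{1 3}cL -!sum_nat_const -big_split; apply: leq_sum => v /(subsetP sLX).
    by rewrite inE => /andP[].
  have := degH u uH.
  set sm := \sum_(v in L) _; rewrite -mulnn.
  move: small; case: (odd k); lia.
(* If [X] were smaller, cutting it into [i] classes, with [i] the quotient [#|X| / k] rounded up,
   would leave outside [X] a vertex of degree at least [k * q.+1 - 2 * k]. *)
have /ex_subset_card[X' sX'X cX'] : k * q.+1 + 1 <= #|X|.
  rewrite addn1 ltnNge; apply/negP => leX.
  pose i := (#|X| + k.-1) %/ k.
  have leXi : #|X| <= k * i.
    by have := divn_eq (#|X| + k.-1) k; have := ltn_pmod (#|X| + k.-1) k_gt0;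
      rewrite -/i; lia.
  have leiX : k * i <= #|X| + k.-1 by rewrite mulnC leq_trunc_div.
  have leiq : i <= q.+1.
    by rewrite -ltnS -(ltn_pmul2l k_gt0) mulnS; lia.
  have nospl' : ~ splits e k (q.+1 - i + i) H by rewrite subnK.
  have [y] := ex_large_degree_outside nospl' sXH leXi.
  rewrite !inE negb_and => /andP[/orP[/negPf->//|/negP ndeg] yH] degy; apply: ndeg.
  have := codegX y yH; rewrite mulnBr in degy.
  have : k * i <= k * q.+1 by rewrite leq_mul2l leiq orbT.
  lia.
have := degree_sum_dense cX'; have := degree_sum_subset e (subset_trans sX'X sXH).
rewrite -mulnn => leE dense; move: small; rewrite ltnNge => /negP[].
apply: leq_trans (dense _ _) _; first by lia.
  by move=> S sS; apply: freeX; apply: subset_trans sX'X.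
by rewrite leq_add2r.
Qed.
End Descent.

(** * Independent sets in the union of the red graph and the missing edges *)

Section Independent.
Variables (T : finType) (j : rel T).
Hypotheses (j_sym : symmetric j) (j_irr : irreflexive j).
Implicit Types (B I W : {set T}).

Definition independent I := {in I &, forall x y, ~~ j x y}.

Lemma ex_independentS q v W : v \in W ->
    (exists I, [/\ I \subset W :\: (v |: [set w in W | j v w]), #|I| = q &
      independent I]) ->
  exists I, [/\ I \subset W, #|I| = q.+1 & independent I].
Proof.
move=> vW [I [sIW cI indI]].
have IP w : w \in I -> [/\ w \in W, w != v & ~~ j v w].
  by move/(subsetP sIW); rewrite !inE negb_or => /andP[/andP[-> nj] wW];
    rewrite wW in nj.
have vI : v \notin I by apply/negP => /IP[_]; rewrite eqxx.
exists (v |: I); split; last 2 first.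
- by rewrite cardsU1 vI cI.
- move=> x y; rewrite !inE => /orP[/eqP->|xI] /orP[/eqP->|yI].
  + by rewrite j_irr.
  + by have [] := IP y yI.
  + by rewrite j_sym; have [] := IP x xI.
  + exact: indI.
by rewrite subUset sub1set vW; apply/subsetP => w /IP[].
Qed.

Lemma ex_independent1 W : 0 < #|W| ->
  exists I, [/\ I \subset W, #|I| = 1 & independent I].
Proof.
case/card_gt0P => v vW; exists [set v]; rewrite sub1set vW cards1; split=> //.
by move=> x y; rewrite !inE => /eqP-> /eqP->; rewrite j_irr.
Qed.

Lemma card_closed_neighbourhood v W : v \in W ->
  #|W| = #|W :\: (v |: [set w in W | j v w])| + (degree_in j W v).+1.
Proof.
move=> vW; rewrite -(cardsID (v |: [set w in W | j v w]) W) addnC; congr (_ + _).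
rewrite (setIidPr _) ?cardsU1 ?inE ?j_irr ?andbF //.
by rewrite subUset sub1set vW; apply/subsetP => w; rewrite inE => /andP[].
Qed.

(* The vertices picked greedily in [B] each destroy at most [k] vertices of
   [W]; the last one is picked anywhere in what remains of [W]. *)
Lemma ex_independent_greedy k q B W : B \subset W ->
    k * q < #|B| + k -> k * q < #|W| -> {in B, forall b, degree_in j W b < k} ->
  exists I, [/\ I \subset W, #|I| = q.+1 & independent I].
Proof.
elim: q B W => [|q IHq] B W sBW; first by rewrite muln0 => _ /ex_independent1.
rewrite mulnS => ltB ltW degB.
have /card_gt0P[b bB] : 0 < #|B| by lia.
have bW := subsetP sBW b bB; apply: (ex_independentS bW).
have := card_closed_neighbourhood bW; have := degB b bB.
set W' := W :\: _ => ltk cW; apply: (IHq (B :&: W')); first exact: subsetIr.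
- have := cardsID W' B; suff : #|B :\: W'| <= #|W :\: W'|.
    have sW' : W' \subset W by apply: subsetDl.
    by rewrite [#|W :\: W'|]cardsD (setIidPr sW'); lia.
  exact/subset_leq_card/setSD.
- by lia.
move=> x /setIP[/degB degx _]; apply: leq_ltn_trans degx.
exact/degree_in_subset/subsetDl.
Qed.

(* If every vertex of [W] has degree exactly [k] then [m] matches [W]
   perfectly; as [k] and [#|W|] are even, [k * q < #|W|] leaves room for
   deleting [k.+1] vertices. *)
Lemma ex_independent_matching k (r m : rel T) q W :
    ~~ odd k -> symmetric m -> irreflexive m -> (forall x y, j x y -> r x y || m x y) ->
    (forall x, #|[set y | r x y]| < k) -> (forall x, #|[set y | m x y]| <= 1) ->
    k * q < #|W| ->
  exists I, [/\ I \subset W, #|I| = q.+1 & independent I].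
Proof.
move=> evenk m_sym m_irr j_rm deg_r deg_m.
elim: q W => [|q IHq] W; first by rewrite muln0 => /ex_independent1.
rewrite mulnS => ltW.
have [/exists_inP[v vW degv]|] := boolP [exists v in W, degree_in j W v < k].
  apply: (ex_independentS vW); apply: IHq.
  by have := card_closed_neighbourhood vW; lia.
rewrite negb_exists_in => /forall_inP degk.
have /card_gt0P[v vW] : 0 < #|W| by lia.
have degj x : degree_in j W x <= #|[set y | r x y]| + degree_in m W x.
  apply: leq_trans (leq_card_setU _ _); apply/subset_leq_card/subsetP => y.
  by rewrite !inE => /andP[-> /j_rm].
have degm x : degree_in m W x <= 1.
  by apply: leq_trans (deg_m x); apply/subset_leq_card/subsetP => y;
    rewrite !inE => /andP[].
apply: (ex_independentS vW); apply: IHq.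
have evenW : ~~ odd #|W|.
  have := degree_sum_even W m_sym m_irr.
  rewrite /degree_sum (eq_bigr (fun=> 1)) ?sum1_card // => x xW.
  by apply/eqP; rewrite eqn_leq degm; have := degk x xW; have := degj x;
    have := deg_r x; lia.
have := card_closed_neighbourhood vW; have := degj v; have := deg_r v; have := degm v.
have : ~~ odd (k + k * q) by rewrite oddD oddM (negPf evenk).
lia.
Qed.
End Independent.

(** * From colourings to independent sets and splittings *)

Lemma arrows_star_complete (F : sgraph) k n :
    (forall r : rel F, symmetric r -> (forall x, #|[set y | r x y]| < k) ->
      exists I : {set F}, #|I| = n /\
        {in I &, forall x y, x != y -> edge x y && ~~ r x y}) ->
  arrows F (star k) (complete n).
Proof.
move=> largeI c; pose r := colour_edge c true.
have [/existsP[v degv]|/existsPn deg_r] := boolP [exists v, k <= #|[set y | r v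
  y]|]; [left | right].
  pose g (o : option 'I_k) : F :=
    if o is Some i then enum_val (widen_ord degv i) else v.
  have gP i : r v (g (Some i)).
    by have := enum_valP (widen_ord degv i); rewrite inE.
  have gNone i : g (Some i) != v.
    by apply: contraTneq (gP i) => ->; rewrite /r colour_irrefl.
  exists g => [[i|] [i'|] /=|[i|] [i'|] //= _].
  - by move/enum_val_inj/(congr1 val) => /= eqi; congr Some; apply: val_inj.
  - by move/eqP; rewrite (negPf (gNone i)).
  - by move/esym/eqP; rewrite (negPf (gNone i')).
  - by [].
  - by rewrite colour_sym; apply: gP.
  - exact: gP.
have [||I [cI cliqueI]] := largeI r; first exact: colour_sym.
  by move=> x; rewrite ltnNge.
pose g (i : 'I_n) : F := enum_val (cast_ord (esym cI) i).
exists g => [x y /enum_val_inj/cast_ord_inj //|x y /= nxy].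
have := cliqueI (g x) (g y) (enum_valP _) (enum_valP _).
rewrite (inj_eq enum_val_inj) (inj_eq (@cast_ord_inj _ _ _)) => /(_ nxy) /andP[exy].
by rewrite /r /colour_edge exy /=; case: (c _).
Qed.

(** With red inside the classes, a red star needs a vertex with [k] neighbours in its own class, and
    a blue clique has at most one vertex per class. *)
Lemma splits_not_arrows (F : sgraph) k q :
  splits (@edge F) k q [set: F] -> ~ arrows F (star k) (complete q.+1).
Proof.
move=> [f fq fk] /(_ (fun S => [forall x in S, forall y in S, f x == f y])).
set c := fun S : {set F} => _.
have cE x y : c [set x; y] = (f x == f y).
  apply/idP/eqP => [|eqf].
    by move/forall_inP/(_ x (set21 _ _))/forall_inP/(_ y (set22 _ _))/eqP.
  by apply/forall_inP => u /set2P[]->; apply/forall_inP => w /set2P[]->; rewrite ?eqf.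
case=> [[g g_inj gP]|[g g_inj gP]].
  have := fk (g None) (in_setT _); rewrite ltnNge => /negP[].
  rewrite -[X in X <= _]card_ord -(card_imset _ (inj_comp g_inj (@Some_inj _))).
  apply/subset_leq_card/subsetP => _ /imsetP[i _ ->].
  have := gP None (Some i) isT.
  by rewrite !inE /= /colour_edge cE eqb_id eq_sym.
pose h (i : 'I_q.+1) : 'I_q := Ordinal (fq (g i) (in_setT _)).
have : injective h.
  move=> x y /(congr1 val) /= eqf; apply/eqP; apply: contraT => nxy.
  by have /andP[_] := gP x y nxy; rewrite cE eqf eqxx.
by move/leq_card; rewrite !card_ord ltnn.
Qed.

Lemma arrows_sub (T : finType) (e e' : rel T) e_sym e_irr e'_sym e'_irr G H :
    (forall x y, e x y -> e' x y) ->
    arrows (@SGraph T e e_sym e_irr) G H -> arrows (@SGraph T e' e'_sym e'_irr) G H.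
Proof.
move=> sub ar c; have [] := ar c => -[g g_inj gP]; [left | right];
  by exists g => // x y /gP /andP[/sub exy cxy]; apply/andP.
Qed.

(** * Extremal graphs *)

Definition extremal_size k q :=
  if odd k then 'C(k * q + 1, 2) - 'C(k, 2) else 'C(k * q + 1, 2) - (k * q) %/ 2.

Lemma extremal_size_double k q : 0 < q ->
  2 * extremal_size k q + (if odd k then k * (k - 1) else k * q) =
  (k * q) ^ 2 + k * q.
Proof.
move=> q_gt0.
have binE i : 2 * 'C(i, 2) = i * i.-1 by rewrite -mul_bin_diag bin1.
have := binE (k * q + 1); rewrite addn1 /= -mulnn /extremal_size addn1.
case: ifPn => kodd.
  have := binE k; have : 'C(k, 2) <= 'C((k * q).+1, 2).
    by apply: leq_bin2l; rewrite leqW // leq_pmulr.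
  by rewrite subn1; lia.
have := divn_eq (k * q) 2; rewrite modn2 oddM (negPf kodd) /= addn0.
by lia.
Qed.

Lemma num_edges_double (F : sgraph) : 2 * num_edges F = degree_sum (@edge F) [set: F].
Proof. by rewrite (handshake (@edge_sym F) (@edge_irrefl F)) mulnC. Qed.

(** For even [k] the slack [1] of the doubled bound vanishes, as two even numbers are compared. *)
Lemma num_edges_geq (F : sgraph) k q : 1 < k -> k ^ 3 + 2 * k ^ 2 + 2 * k <= q.+1 ->
  arrows F (star k) (complete q.+1) -> extremal_size k q <= num_edges F.
Proof.
move=> k_gt1 leq ar.
have := degree_sum_geq_sharp (@edge_sym F) (@edge_irrefl F) k_gt1 leq.
move=> /(_ [set: F]); rewrite -num_edges_double => bound.
have {}bound := bound (fun spl => splits_not_arrows spl ar).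
have q_gt0 : 0 < q by move: leq; rewrite !expnS; nia.
have := extremal_size_double k q_gt0; move: bound.
by case: (odd k); lia.
Qed.

Lemma card_ord_lt N k : k <= N -> #|[set x : 'I_N | x < k]| = k.
Proof.
move=> lekN; have w_inj : injective (widen_ord lekN).
  by move=> x y /(congr1 val) /= /val_inj.
rewrite -[RHS]card_ord -(card_imset _ w_inj); apply: eq_card => x.
rewrite inE; apply/idP/imsetP => [ltxk|[i _ ->]]; last exact: (ltn_ord i).
by exists (Ordinal ltxk) => //; apply: val_inj.
Qed.

(** Only edges inside [K], the first [k] vertices, are missing. In [j], made of non-edges and red
    edges, vertices outside [K] have degree below [k], so they can serve for the greedy choice. *)
Lemma ex_arrows_odd k q : 0 < k -> 0 < q ->
  exists (e : rel 'I_(k * q + 1)) (e_sym : symmetric e) (e_irr : irreflexive e),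
    arrows (SGraph e_sym e_irr) (star k) (complete q.+1) /\
    2 * num_edges (SGraph e_sym e_irr) + k * (k - 1) <= (k * q) ^ 2 + k * q.
Proof.
move=> k_gt0 q_gt0; set N := k * q + 1.
pose e : rel 'I_N := fun x y => (x != y) && ~~ ((x < k) && (y < k)).
have e_sym : symmetric e by move=> x y; rewrite /e eq_sym [(x < k) && _]andbC.
have e_irr : irreflexive e by move=> x; rewrite /e eqxx.
exists e, e_sym, e_irr; pose K := [set x : 'I_N | x < k].
have lekN : k <= N by rewrite /N addn1 leqW // leq_pmulr.
have cK : #|K| = k by apply: card_ord_lt.
split.
  apply: arrows_star_complete => r r_sym deg_r.
  pose j : rel 'I_N := fun x y => (x != y) && ~~ (e x y && ~~ r x y).
  have j_sym : symmetric j by move=> x y; rewrite /j eq_sym e_sym r_sym.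
  have j_irr : irreflexive j by move=> x; rewrite /j eqxx.
  have := @ex_independent_greedy _ j j_sym j_irr k q (~: K) setT (subsetT _).
  have := cardsC K; rewrite cK cardsT card_ord => cKN [|||I [_ cI indI]].
  - by rewrite addnC cKN /N addn1.
  - by rewrite /N addn1.
  - move=> b; rewrite inE inE => bK; apply: leq_ltn_trans (deg_r b).
    apply/subset_leq_card/subsetP => w.
    by rewrite !inE /j /e (negPf bK) /=; case: (b != w); rewrite //= negbK.
  exists I; split=> // x y xI yI nxy.
  by have := indI x y xI yI; rewrite /j nxy negbK.
rewrite num_edges_double /=.
have := degree_sum_compl e_irr [set: 'I_N]; rewrite cardsT card_ord.
have -> : N * N.-1 = (k * q) ^ 2 + k * q by rewrite /N addn1 /= -mulnn; lia.
suff : k * (k - 1) <= degree_sum (compl_rel e) [set: 'I_N].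
  by move=> leK <-; rewrite leq_add2l.
apply: leq_trans (degree_sum_subset _ (subsetT K)).
rewrite -{1}cK -sum_nat_const; apply: leq_sum => x xK.
have -> : k - 1 = #|K :\ x| by have := cardsD1 x K; rewrite xK cK; lia.
apply/subset_leq_card/subsetP => y; rewrite !inE => /andP[nyx yK].
by rewrite yK /compl_rel /e nyx eq_sym nyx; move: xK; rewrite inE => ->; rewrite yK.
Qed.

(** The non-edges pair up vertices with equal halves [x./2]; as [k * q + 1] is odd, the last vertex
    stays unpaired. *)
Lemma ex_arrows_even k q : ~~ odd k ->
  exists (e : rel 'I_(k * q + 1)) (e_sym : symmetric e) (e_irr : irreflexive e),
    arrows (SGraph e_sym e_irr) (star k) (complete q.+1) /\
    2 * num_edges (SGraph e_sym e_irr) <= (k * q) ^ 2.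
Proof.
move=> evenk; set N := k * q + 1.
pose e : rel 'I_N := fun x y => x./2 != y./2.
have e_sym : symmetric e by move=> x y; rewrite /e eq_sym.
have e_irr : irreflexive e by move=> x; rewrite /e eqxx.
exists e, e_sym, e_irr; split.
  apply: arrows_star_complete => r r_sym deg_r.
  pose j : rel 'I_N := fun x y => (x != y) && ~~ (e x y && ~~ r x y).
  have j_sym : symmetric j by move=> x y; rewrite /j eq_sym e_sym r_sym.
  have j_irr : irreflexive j by move=> x; rewrite /j eqxx.
  have [|||I [_ cI indI]] := @ex_independent_matching _ j j_sym j_irr k r
    (compl_rel e) q setT
    evenk (compl_rel_sym e_sym) (compl_rel_irr e) _ deg_r.
  - move=> x y; rewrite /j /compl_rel eq_sym => /andP[-> ].
    by rewrite negb_and negbK orbC.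
  - move=> x; apply/card_le1_eqP => y z; rewrite !inE /compl_rel /e !negbK.
    move=> /andP[nyx /eqP yx] /andP[nzx /eqP zx]; apply: val_inj => /=.
    by move: nyx nzx; rewrite -!val_eqE /=; lia.
  - by rewrite cardsT card_ord /N; lia.
  exists I; split=> // x y xI yI nxy.
  by have := indI x y xI yI; rewrite /j nxy negbK.
rewrite num_edges_double /=.
have := degree_sum_compl e_irr [set: 'I_N]; rewrite cardsT card_ord.
have -> : N * N.-1 = (k * q) ^ 2 + k * q by rewrite /N addn1 /= -mulnn; lia.
suff : k * q <= degree_sum (compl_rel e) [set: 'I_N].
  by move=> leK sumE; rewrite -(leq_add2r (k * q)) -sumE leq_add2l.
have evenkq : ~~ odd (k * q) by rewrite oddM negb_and evenk.
have /card_ord_lt {1}<- : k * q <= N by rewrite /N leq_addr.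
apply: leq_trans (degree_sum_subset _ (subsetT [set x : 'I_N | x < k * q])).
rewrite -sum1_card; apply: leq_sum => x; rewrite inE => ltx; apply/degree_in_gt0P.
have lty : (if odd x then x.-1 else x.+1) < k * q by case: ifP; lia.
have ltyN : (if odd x then x.-1 else x.+1) < N.
  by apply: leq_trans lty _; rewrite leq_addr.
exists (Ordinal ltyN); first by rewrite inE.
by rewrite /compl_rel /e -val_eqE /= negbK; case: ifP => oddx; apply/andP; split; lia.
Qed.

(** * The Ramsey number and the two size Ramsey numbers *)

Lemma complete_not_arrows k q N : 0 < k ->
  arrows (complete N) (star k) (complete q.+1) -> k * q < N.
Proof.
move=> k_gt0 ar; rewrite ltnNge; apply/negP => leN.
apply: (@splits_not_arrows (complete N) k q) ar; rewrite -[q]add0n.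
apply: (splits_setD (@edge_irrefl (complete N)) k_gt0 (A := setT)).
  by rewrite cardsT card_ord.
by exists (fun=> 0) => v; rewrite setDv inE.
Qed.

Lemma ex_arrows_extremal k q : 0 < k -> 0 < q ->
  exists (e : rel 'I_(k * q + 1)) (e_sym : symmetric e) (e_irr : irreflexive e),
    arrows (SGraph e_sym e_irr) (star k) (complete q.+1) /\
    num_edges (SGraph e_sym e_irr) <= extremal_size k q.
Proof.
move=> k_gt0 q_gt0; have := extremal_size_double k q_gt0.
case: ifPn => [_|evenk] sizeE.
  have [e [e_sym [e_irr [ar le]]]] := ex_arrows_odd k_gt0 q_gt0.
  by exists e, e_sym, e_irr; split=> //; lia.
have [e [e_sym [e_irr [ar le]]]] := ex_arrows_even q evenk.
by exists e, e_sym, e_irr; split=> //; lia.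
Qed.

(** The extremal graph on [k * q + 1] vertices already arrows, hence so does the complete graph
    containing it. *)
Lemma ramsey_star_complete k q : 0 < k -> 0 < q ->
  is_ramsey (star k) (complete q.+1) (k * q + 1).
Proof.
move=> k_gt0 q_gt0; split=> [|N /(complete_not_arrows k_gt0)]; last by rewrite addn1.
have [e [e_sym [e_irr [ar _]]]] := ex_arrows_extremal k_gt0 q_gt0.
by apply: arrows_sub ar => x y; apply: contraTneq => ->; rewrite e_irr.
Qed.

Theorem theorem3 (k n : nat) (hk : 2 <= k)
    (hn : k ^ 3 + 2 * k ^ 2 + 2 * k <= n) :
  let m := if odd k then 'C(k * (n - 1) + 1, 2) - 'C(k, 2)
           else 'C(k * (n - 1) + 1, 2) - (k * (n - 1)) %/ 2 in
  is_size_ramsey (star k) (complete n) m /\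
  is_restricted_size_ramsey (star k) (complete n) m.
Proof.
have k_gt0 : 0 < k by apply: ltnW.
have n_gt1 : 1 < n by apply: leq_trans hn; rewrite !expnS; nia.
case: n n_gt1 hn => // q; rewrite ltnS => q_gt0 leq; rewrite subn1 [q.+1.-1]/=.
rewrite -/(extremal_size k q) => m.
have lower (F : sgraph) : arrows F (star k) (complete q.+1) -> m <= num_edges F.
  exact: num_edges_geq.
(* This graph has [k * q + 1] vertices, the Ramsey number, so it attains both minima. *)
have [e [e_sym [e_irr [ar leF]]]] := ex_arrows_extremal k_gt0 q_gt0.
have sizeF : num_edges (SGraph e_sym e_irr) = m.
  by apply/eqP; rewrite eqn_leq leF lower.
split; split.
- by exists (SGraph e_sym e_irr).
- by move=> _ [F [arF <-]]; apply: lower.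
- exists (SGraph e_sym e_irr); split=> //.
  by rewrite card_ord; apply: ramsey_star_complete.
- by move=> _ [F [arF _ <-]]; apply: lower.
Qed.
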